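(* Let $b\in\mathbb{R}$ with $b>0$ and $b\neq 1$. The quadratic quadrinomial $Q_{b,b}(z)=bz^2+\overline{z}^{\,2}+b\,\overline{z}+z$ has no $\mathcal{M}_{b,b}$-modular roots; that is, there is no $z\in\mathbb{C}$ with $Q_{b,b}(z)=0$ and $|z|=\mathcal{M}_{b,b}$, where $\mathcal{M}_{b,b}=\left[\frac{b^2-1}{k^2(b^2-1)}\right]^{\frac{1}{2k-2}}$ with $k=2$.
   Context: For $b,c\in\mathbb{R}^+\setminus\{1\}$ and $k,n,m\in\mathbb{N}$ with $k\ge n>m$, let $Q_{b,c}(z)=bz^k+\overline{z}^{\,n}+c\,\overline{z}^{\,m}+z$ and $\mathcal{M}_{b,c}=\left[\frac{c^2-1}{k^2(b^2-1)}\right]^{\frac{1}{2k-2}}$. The quadrinomial is called quadratic if both its analytic part $bz^k+z$ and its co-analytic part $z^n+cz^m$ are quadratic polynomials, i.e. $k=n=2$ and $m=1$. A root of $Q_{b,c}$ is called $\mathcal{M}_{b,c}$-modular if it lies on the circle $|z|=\mathcal{M}_{b,c}$. *)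

(* Defs.v *)
From Stdlib Require Import Reals.
From Coquelicot Require Import Coquelicot.

Open Scope R_scope.

Definition quadrinomial (b c : R) (k n m : nat) (z : C) : C :=
  (RtoC b * z ^ k + Cconj z ^ n + RtoC c * Cconj z ^ m + z)%C.

(* [Rpower x y] is [exp (y * ln x)], the real power only for [0 < x]; hence
   [modulus b c k] is meaningful for positive [b] and [c] on the same side of 1
   (in particular for [b = c], [b <> 1]) and [2 <= k]. *)
Definition modulus (b c : R) (k : nat) : R :=
  Rpower ((c ^ 2 - 1) / (INR k ^ 2 * (b ^ 2 - 1))) (1 / (2 * INR k - 2)).

Definition modular_root (b c : R) (k n m : nat) (z : C) : Prop :=
  quadrinomial b c k n m z = RtoC 0 /\ Cmod z = modulus b c k.

(* Main.v *)
Require Import Defs.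
From Stdlib Require Import Reals Lra.
From Coquelicot Require Import Coquelicot.

Open Scope R_scope.

(** When [c = b] and [k = 2] the factors [b ^ 2 - 1] cancel and the modular
    circle is [|z| = 1/2] for every [b]; a root on it is ruled out by real
    coordinates. For [z = x + i y] the real part of the equation carries the
    factor [b + 1 > 0] and the imaginary part the factor [b - 1 <> 0], so the
    roots do not depend on [b]: they are the solutions of
    [x^2 - y^2 + x = 0] and [y (2 x - 1) = 0]. These are [0], [-1] and
    [1/2 +- i sqrt 3 / 2], of modulus [0] or [1], never [1/2]. *)

Lemma modulus_diag_2 (b : R) :
  0 < b -> b <> 1 -> modulus b b 2 = / 2.
Proof.
intros hb hb1; unfold modulus; simpl INR.
assert (hb2 : b ^ 2 - 1 <> 0).
{ replace (b ^ 2 - 1) with ((b - 1) * (b + 1)) by ring.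
  apply Rmult_integral_contrapositive; split; lra. }
replace (_ / _) with (/ 2 * / 2) by (field; exact hb2).
replace (1 / _) with (/ 2) by field.
rewrite Rpower_sqrt by lra.
apply sqrt_square; lra.
Qed.

Lemma quadratic_root_coords (b x y : R) :
  0 < b -> b <> 1 -> quadrinomial b b 2 2 1 (x, y) = RtoC 0 ->
  x ^ 2 - y ^ 2 + x = 0 /\ y * (2 * x - 1) = 0.
Proof.
intros hb hb1 hQ.
pose proof (f_equal Re hQ) as hre; pose proof (f_equal Im hQ) as him.
unfold quadrinomial in hre, him; simpl in hre, him.
split.
- apply (Rmult_eq_reg_l (b + 1)); [|lra].
  rewrite Rmult_0_r, <- hre; ring.
- apply (Rmult_eq_reg_l (b - 1)); [|lra].
  rewrite Rmult_0_r, <- him; ring.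
Qed.

Theorem theorem3p2 (b : R) (hb : 0 < b) (hb1 : b <> 1) :
  ~ (exists z : C, modular_root b b 2 2 1 z).
Proof.
intros [[x y] [hQ hmod]].
rewrite modulus_diag_2 in hmod by assumption.
destruct (quadratic_root_coords b x y hb hb1 hQ) as [hre him].
assert (hcirc : x ^ 2 + y ^ 2 = / 4).
{ change (sqrt (x ^ 2 + y ^ 2) = / 2) in hmod.
  rewrite <- (pow2_sqrt (x ^ 2 + y ^ 2)) by nra.
  rewrite hmod; field. }
destruct (Rmult_integral _ _ him) as [hy | hx].
- subst y; nra.
- assert (x = / 2) by lra; subst x; nra.
Qed.
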